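(* Let $k\ge 1$ be an odd square-free integer with $\gcd(k,5)=1$, and let $K_k=\mathbb{Q}\big(\sqrt{k(5+\sqrt5)}\big)$. Then \[ \tfrac{1}{1920}\, D_{K_k}^{1/2} \le M(\mathcal{O}_{K_k}) \le D_{K_k}^{1/2}. \]
   Context: For a nonconstant polynomial $f(x)=c\prod_{i=1}^d (x-\alpha_i)\in\mathbb{C}[x]$, the Mahler measure is $M(f)=|c|\prod_{|\alpha_i|\ge 1}|\alpha_i|$. For an algebraic number $\alpha$, $M(\alpha)$ is the Mahler measure of its minimal polynomial over $\mathbb{Z}$ (with content $1$). For a number field $K$ with ring of integers $\mathcal{O}_K$ and absolute discriminant $D_K$, $M(\mathcal{O}_K)=\min\{M(\alpha):\alpha\in\mathcal{O}_K,\ \mathbb{Q}(\alpha)=K\}$. *)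

(* Defs.v *)
From HB Require Import structures.
From mathcomp Require Import all_boot all_order all_algebra all_field.
Set Implicit Arguments. Unset Strict Implicit. Unset Printing Implicit Defensive.
Import Order.TTheory GRing.Theory Num.Theory.
Local Open Scope ring_scope.

(* All number fields live inside algC (algebraic complex numbers).
   A number field is presented as Q(b) for a generator b : algC. *)

Definition squarefree (k : nat) : Prop :=
  forall p : nat, prime p -> ~~ (p * p %| k)%N.

Definition in_Qgen (b x : algC) : Prop :=
  exists p : {poly rat}, x = (map_poly ratr p).[b].

Definition in_OK (b x : algC) : Prop := in_Qgen b x /\ x \in Aint.

Definition same_field (b a : algC) : Prop := in_Qgen b a /\ in_Qgen a b.

Definition poly_mahler (f : {poly algC}) (m : algC) : Prop :=
  exists rs : seq algC,
    f = lead_coef f *: \prod_(r <- rs) ('X - r%:P) /\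
    m = `|lead_coef f| * \prod_(r <- rs | 1 <= `|r|) `|r|.

(* f is the minimal polynomial of a over Z with content 1
   (i.e. the least positive integer multiple of the monic rational
   minimal polynomial lying in Z[x]; unique up to sign). *)
Definition minZpoly (a : algC) (f : {poly algC}) : Prop :=
  exists c : nat, (0 < c)%N /\ f = c%:R *: minCpoly a /\
    f \is a polyOver Num.int /\
    forall d : nat, (0 < d < c)%N -> ~~ (d%:R *: minCpoly a \is a polyOver Num.int).

Definition alg_mahler (a m : algC) : Prop :=
  exists f, minZpoly a f /\ poly_mahler f m.

Definition is_mahler_OK (b m : algC) : Prop :=
  (exists a, in_OK b a /\ same_field b a /\ alg_mahler a m) /\
  forall a m', in_OK b a -> same_field b a -> alg_mahler a m' -> m <= m'.

(* D is the absolute discriminant |disc(K)| of K = Q(b):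
   rs lists the conjugates of b (so the embeddings of K are p(b) |-> p(rs i)),
   B j = (P j).[b] is a Z-basis of O_K, and
   D = |det (sigma_i (B j))|^2. *)
Definition abs_disc (b D : algC) : Prop :=
  exists (n : nat) (rs : 'I_n -> algC) (P : 'I_n -> {poly rat}),
    let B j := (map_poly ratr (P j)).[b] in
    minCpoly b = \prod_(i < n) ('X - (rs i)%:P) /\
    (forall j, B j \in Aint) /\
    (forall x, in_OK b x -> exists z : 'I_n -> int, x = \sum_j (z j)%:~R * B j) /\
    (forall z : 'I_n -> int, \sum_j (z j)%:~R * B j = 0 -> forall j, z j = 0) /\
    D = `| \det (\matrix_(i, j) (map_poly ratr (P j)).[rs i]) | ^+ 2.

(* Main.v *)
(* Write s = sqrt 5, phi = (1 + s)/2, b = sqrt (k (5 + s)), b' = sqrt (k (5 - s)),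
   so that b b' = 2 k s, and the conjugates of b are b, -b, b', -b', the
   polynomial X^4 - 10 k X^2 + 20 k^2 being Eisenstein at 5.

   Ring of integers: b^2 = 2 s phi k, where phi is a unit and 10 k is
   squarefree, so reducing modulo each prime divisor of 10 k, and then modulo
   the inert prime 2, shows that O_K = Z[phi] + Z[phi] b.  Evaluating the
   determinant on this basis gives D^(1/2) = 40 s k.

   Lower bound: if a = x + y b generates K, the inequality
   |u - v| <= 2 max(1,|u|) max(1,|v|), applied to x + y b, x - y b and to their
   conjugates x' + y' b', x' - y' b', gives M(a) >= |y y'| b b' >= 2 s k, since
   y y' is a nonzero integer.

   Upper bound: round (b, b') in the lattice Z[phi] to (x, x') with
   |x - b|, |x' - b'| <= 3/2.  Then a = x + b has two conjugates of size at
   most 3/2, and the other two at most 2 b + 3/2 and 2 b' + 3/2. *)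
Require Import Defs.
From HB Require Import structures.
From mathcomp Require Import all_boot all_order all_algebra all_field perm.
From mathcomp Require Import ring lra zify.
Set Implicit Arguments. Unset Strict Implicit. Unset Printing Implicit Defensive.
Import Order.TTheory GRing.Theory Num.Theory.
Local Open Scope ring_scope.

(** * Rational polynomials evaluated at conjugate numbers *)

Local Notation ev p x := (map_poly (ratr : rat -> algC) p).[x].

Lemma ev_comp (p q : {poly rat}) (x : algC) : ev (p \Po q) x = ev p (ev q x).
Proof. by rewrite map_comp_poly horner_comp. Qed.

(** Such a [p] is a multiple of the minimal polynomial of [x]. Identities proved at one generator
    are carried to all its conjugates this way. *)
Lemma root_minCpoly_conj (x r : algC) (p : {poly rat}) :
  root (minCpoly x) r -> ev p x = 0 -> ev p r = 0.
Proof.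
have [q [-> _] qP] := minCpolyP x => rr /eqP px.
have /dvdpP[h ->] : q %| p by rewrite -qP; apply/rootP/eqP.
by rewrite rmorphM hornerM (rootP rr) mulr0.
Qed.

Lemma root_minCpoly_ev (x r : algC) (p : {poly rat}) :
  root (minCpoly x) r -> root (minCpoly (ev p x)) (ev p r).
Proof.
have [q [eq _] _] := minCpolyP (ev p x); rewrite eq => rr.
apply/rootP; rewrite -ev_comp (root_minCpoly_conj rr) // ev_comp.
by apply/rootP; rewrite -eq root_minCpoly.
Qed.

Lemma Aint_conj (x r : algC) (p : {poly rat}) :
  root (minCpoly x) r -> ev p x \in Aint -> ev p r \in Aint.
Proof.
move=> rr xA; apply: (root_monic_Aint (root_minCpoly_ev p rr)) => //.
exact: minCpoly_monic.
Qed.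

Lemma ratrM (x y : rat) : ratr (x * y) = ratr x * ratr y :> algC.
Proof. by rewrite rmorphM. Qed.

Lemma ratrD (x y : rat) : ratr (x + y) = ratr x + ratr y :> algC.
Proof. by rewrite rmorphD. Qed.

Lemma ratrB (x y : rat) : ratr (x - y) = ratr x - ratr y :> algC.
Proof. by rewrite rmorphB. Qed.

Lemma ratrN (x : rat) : ratr (- x) = - ratr x :> algC.
Proof. by rewrite rmorphN. Qed.

(** * The quartic and its irreducibility *)

Definition quartic (k : nat) : {poly rat} :=
  'X^4 - (10 * k)%:R *: 'X^2 + (20 * k ^ 2)%:R%:P.

Lemma quartic_irreducible (k : nat) :
  coprime k 5 -> irreducible_poly (quartic k).
Proof.
move=> k5.
pose q : {poly int} := Poly [:: (20 * k ^ 2)%:R; 0; - (10 * k)%:R; 0; 1].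
have sq : (q : seq int) = [:: (20 * k ^ 2)%:R; 0; - (10 * k)%:R; 0; 1].
  by rewrite (PolyK (c := 0)).
have -> : quartic k = map_poly intr q.
  apply/polyP=> i; rewrite coef_map /= sq /quartic !coefE.
  by case: i => [|[|[|[|[|i]]]]] //=; rewrite ?nth_nil; ring.
have p5 : ~~ (5 %| k)%N by rewrite -prime_coprime // coprime_sym.
apply/irreducible_rat_int/(@eisenstein_crit 5) => //; rewrite ?sq // ?lead_coefE ?sq //=.
(* If 25 divided the constant term, 5 would divide 4 k^2. *)
- apply/negP => /dvdzP [x xk]; have : (5 %| 4 * (k * k))%N by lia.
  by rewrite !Euclid_dvdM // !(negbTE p5).
- by move=> [|[|[|[|i]]]] //= _; lia.
Qed.

(** * Explicit conjugates and the minimal polynomial of the generator *)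

Definition sqrt5 : algC := sqrtC 5.
Definition beta (k : nat) : algC := sqrtC (k%:R * (5 + sqrt5)).
Definition beta' (k : nat) : algC := sqrtC (k%:R * (5 - sqrt5)).
Definition phi : algC := (1 + sqrt5) / 2.
Definition phi' : algC := (1 - sqrt5) / 2.
Definition conjs (k : nat) : seq algC :=
  [:: beta k; - beta k; beta' k; - beta' k].

Lemma sqr_sqrt5 : sqrt5 ^+ 2 = 5.
Proof. exact: sqrtCK. Qed.

Lemma sqrt5_ge0 : 0 <= sqrt5.
Proof. by rewrite sqrtC_ge0. Qed.

Lemma sqrt5_gt2 : 2 < sqrt5.
Proof.
by rewrite -(ltr_pXn2r (n := 2)) ?nnegrE ?sqrt5_ge0 // sqr_sqrt5 -natrX ltr_nat.
Qed.

Lemma sqrt5_lt : sqrt5 < 9 / 4.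
Proof.
rewrite -(ltr_pXn2r (n := 2)) ?nnegrE ?sqrt5_ge0 ?divr_ge0 //.
rewrite sqr_sqrt5 expr_div_n ltr_pdivlMr ?exprn_gt0 //.
by rewrite -!natrX -natrM ltr_nat.
Qed.

Lemma subr_sqrt5_gt0 : 0 < 5 - sqrt5.
Proof.
rewrite subr_gt0 (lt_trans sqrt5_lt) // ltr_pdivrMr // -natrM ltr_nat //.
Qed.

Lemma sqr_beta k : beta k ^+ 2 = k%:R * (5 + sqrt5).
Proof. exact: sqrtCK. Qed.

Lemma sqr_beta' k : beta' k ^+ 2 = k%:R * (5 - sqrt5).
Proof. exact: sqrtCK. Qed.

Lemma beta_gt0 k : (0 < k)%N -> 0 < beta k.
Proof.
move=> k0; rewrite sqrtC_gt0 mulr_gt0 ?ltr0n // addr_gt0 //.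
exact: lt_trans sqrt5_gt2.
Qed.

Lemma beta'_gt0 k : (0 < k)%N -> 0 < beta' k.
Proof. by move=> k0; rewrite sqrtC_gt0 mulr_gt0 ?ltr0n // subr_sqrt5_gt0. Qed.

(** Since (5 + sqrt5)(5 - sqrt5) = 20 = (2 sqrt5)^2; nonnegativity of the factors makes the square
    root multiplicative. *)
Lemma beta_mul k : beta k * beta' k = 2 * k%:R * sqrt5.
Proof.
have ge0 : 0 <= 5 + sqrt5 by rewrite addr_ge0 // sqrt5_ge0.
have ge0' := ltW subr_sqrt5_gt0.
rewrite /beta /beta' -rootCMl ?mulr_ge0 //.
have -> : k%:R * (5 + sqrt5) * (k%:R * (5 - sqrt5)) = (2 * k%:R * sqrt5) ^+ 2.
  by ring: sqr_sqrt5.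
rewrite sqrCK //; apply: mulr_ge0; last exact: sqrt5_ge0.
exact: mulr_ge0.
Qed.

Lemma map_quartic k : map_poly ratr (quartic k) =
  'X^4 - (10 * k)%:R *: 'X^2 + (20 * k ^ 2)%:R%:P :> {poly algC}.
Proof.
rewrite /quartic rmorphD rmorphB /= map_polyZ !map_polyXn map_polyC /=.
by rewrite !ratr_nat.
Qed.

Lemma prod_conjs k :
  \prod_(r <- conjs k) ('X - r%:P) = map_poly ratr (quartic k).
Proof.
rewrite map_quartic !big_cons big_nil mulr1 mulrA.
have pairE x : ('X - x%:P) * ('X - (- x)%:P) = 'X^2 - (x ^+ 2)%:P :> {poly algC}.
  by rewrite polyCN opprK -subr_sqr polyC_exp.
rewrite !pairE sqr_beta sqr_beta' -mul_polyC.
have e1 : (10 * k)%:R = k%:R * (5 + sqrt5) + k%:R * (5 - sqrt5) by ring.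
have e2 : (20 * k ^ 2)%:R = (k%:R * (5 + sqrt5)) * (k%:R * (5 - sqrt5)).
  by ring: sqr_sqrt5.
rewrite e1 e2 polyCD !polyCM; ring.
Qed.

Lemma quartic_monic k : quartic k \is monic.
Proof.
have : map_poly ratr (quartic k) \is @monic algC.
  by rewrite -prod_conjs monic_prod_XsubC.
by rewrite map_monic.
Qed.

Lemma minCpoly_beta k : coprime k 5 ->
  minCpoly (beta k) = \prod_(r <- conjs k) ('X - r%:P).
Proof.
move=> k5; rewrite prod_conjs.
have [q [eq qm] qP] := minCpolyP (beta k).
rewrite eq; congr map_poly; apply/eqP; rewrite -eqp_monic ?quartic_monic //.
have [_ irr] := quartic_irreducible k5; apply: irr.
  have := size_minCpoly (beta k); rewrite eq size_map_poly.
  by case: (size q) => [|[]].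
by rewrite -qP -prod_conjs root_prod_XsubC mem_head.
Qed.

Lemma root_minCpoly_beta k r : coprime k 5 ->
  root (minCpoly (beta k)) r = (r \in conjs k).
Proof. by move=> k5; rewrite minCpoly_beta // root_prod_XsubC. Qed.

Lemma conjs_uniq k : (0 < k)%N -> uniq (conjs k).
Proof.
move=> k0; have b0 := beta_gt0 k0; have b'0 := beta'_gt0 k0.
have lt : beta' k < beta k.
  rewrite -(ltr_pXn2r (n := 2)) ?nnegrE ?ltW // sqr_beta sqr_beta'.
  rewrite ltr_pM2l ?ltr0n // ltrD2l gtrN //.
  exact: lt_trans sqrt5_gt2.
have np (x y : algC) : 0 < x -> 0 < y -> - x != y.
  move=> x0 y0; apply: contraTneq y0 => <-.
  by rewrite oppr_gt0 lt_gtF.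
rewrite /= !inE !negb_or eqr_opp.
rewrite (gt_eqF lt) ![beta _ == - _]eq_sym ![beta' _ == - _]eq_sym !np //.
Qed.

(** * Coordinates over Q(sqrt5) and the integers of Q(sqrt5) *)

(** Reduce [p] modulo the quartic and eliminate r^2 and r^3 by r^2 = k (5 + s). The coordinates come
    before [s] and [r], so that the same four rationals serve for every conjugate. *)
Lemma ev_coords k (p : {poly rat}) : exists u v w z : rat,
  forall s r : algC, s ^+ 2 = 5 -> r ^+ 2 = k%:R * (5 + s) ->
  ev p r = (ratr u + ratr v * s) + (ratr w + ratr z * s) * r.
Proof.
pose q := p %% quartic k.
have szq : (size q <= 4)%N.
  have : quartic k != 0 by exact/monic_neq0/quartic_monic.
  move=> /(ltn_modpN0 p); rewrite -/q -(size_map_poly (ratr : rat -> algC) (quartic k)).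
  by rewrite -prod_conjs size_prod_XsubC.
exists (q`_0 + (5 * k)%:R * q`_2), (k%:R * q`_2).
exists (q`_1 + (5 * k)%:R * q`_3), (k%:R * q`_3) => s r s2 r2.
rewrite [p](divp_eq p (quartic k)) -/q rmorphD rmorphM hornerD hornerM /=.
rewrite map_quartic 2!hornerD hornerN hornerZ !hornerXn hornerC.
have -> : r ^+ 4 - (10 * k)%:R * r ^+ 2 + (20 * k ^ 2)%:R = 0.
  by ring: s2 r2.
rewrite mulr0 add0r (horner_coef_wide (n := 4)) ?size_map_poly //.
rewrite !big_ord_recr big_ord0 /= !coef_map /=.
rewrite !ratrD !ratrM !ratr_nat.
have r3 : r ^+ 3 = r * (k%:R * (5 + s)) by rewrite -r2; ring.
rewrite expr0 expr1 r2 r3; ring.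
Qed.

Lemma root_monic_int_Aint (p : {poly int}) (x : algC) :
  p \is monic -> root (map_poly intr p) x -> x \in Aint.
Proof.
move=> pm px; apply: (root_monic_Aint px); first exact: monic_map.
by apply/polyOverP => i; rewrite coef_map intr_int.
Qed.

Lemma Aint_sqrt5 : sqrt5 \in Aint.
Proof.
apply: (root_monic_int_Aint (p := 'X^2 - 5%:P)); first exact: monicXnsubC.
rewrite rmorphB /= map_polyXn map_polyC; apply/rootP.
by rewrite !hornerE sqr_sqrt5 subrr.
Qed.

Lemma Aint_phi : phi \in Aint.
Proof.
apply: (root_monic_int_Aint (p := 'X^2 - ('X + 1%:P))).
  by rewrite monicE lead_coefDl ?lead_coefXn // size_polyN size_XaddC size_polyXn.
rewrite rmorphB rmorphD /= map_polyXn map_polyC map_polyX; apply/rootP.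
by rewrite !hornerE /phi; field: sqr_sqrt5.
Qed.

Lemma Aint_beta k : beta k \in Aint.
Proof.
apply: (root_monic_int_Aint
    (p := 'X^4 - ((10 * k)%:R *: 'X^2 - (20 * k ^ 2)%:R%:P))).
  rewrite monicE lead_coefDl ?lead_coefXn // size_polyN size_polyXn ltnS.
  rewrite (leq_trans (size_polyD _ _)) // size_polyN geq_max.
  rewrite (leq_trans (size_scale_leq _ _)) ?size_polyXn //.
  by rewrite (leq_trans (size_polyC_leq1 _)).
have := mem_head (beta k) [:: - beta k; beta' k; - beta' k].
rewrite -/(conjs k) -root_prod_XsubC prod_conjs map_quartic.
congr (root _ _); rewrite !rmorphB /= map_polyZ !map_polyXn map_polyC /=.
by rewrite !rmorph_nat opprB addrAC -addrA.
Qed.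

Lemma ratr_Aint (q : rat) : ratr q \in Aint -> exists n : int, q = n%:~R.
Proof.
move=> qA; have /Cint_rat_Aint/(_ qA) : ratr q \in Crat by exact: Crat_rat.
move=> /intrP[n qn]; exists n; apply: (fmorph_inj (ratr : rat -> algC)).
by rewrite /= qn ratr_int.
Qed.

(** The conclusion says u + v sqrt5 = m + n phi. The trace a = 2u, the number c = 10v = (x - y)
    sqrt5 and the norm d are rational algebraic integers; 5 a^2 - c^2 = 20 d gives c = 5n, and then
    a and n have the same parity. *)
Lemma ring_of_integers_sqrt5 (u v : rat) :
  ratr u + ratr v * sqrt5 \in Aint -> ratr u - ratr v * sqrt5 \in Aint ->
  exists m n : int, u = m%:~R + n%:~R / 2 /\ v = n%:~R / 2.
Proof.
set x := (X in X \in _) => xA; set y := (X in X \in _) => yA.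
have [a ua] : exists a : int, 2 * u = a%:~R.
  apply: ratr_Aint; suff -> : ratr (2 * u) = x + y by exact: rpredD.
  by rewrite rmorphM /= ratr_nat /x /y; ring.
have [c vc] : exists c : int, 10 * v = c%:~R.
  apply: ratr_Aint; suff -> : ratr (10 * v) = (x - y) * sqrt5.
    by apply: rpredM Aint_sqrt5; exact: rpredB.
  by rewrite rmorphM /= ratr_nat /x /y; ring: sqr_sqrt5.
have [d nd] : exists d : int, u * u - 5 * (v * v) = d%:~R.
  apply: ratr_Aint; suff -> : ratr (u * u - 5 * (v * v)) = x * y by exact: rpredM.
  by rewrite rmorphB !rmorphM /= ratr_nat /x /y; ring: sqr_sqrt5.
have eq : 5 * (a * a) - c * c = 20 * d.
  apply: (intr_inj (R := rat)); rewrite rmorphB !rmorphM /= -ua -vc -nd.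
  by field.
have [n cn] : exists n : int, c = 5 * n.
  have : (5 %| `|c|)%N.
    suff : (5 %| `|c| * `|c|)%N by rewrite Euclid_dvdM // orbb.
    lia.
  by move=> /dvdnP[n e]; exists (c %/ 5)%Z; lia.
have eq2 : a * a - 5 * (n * n) = 4 * d by lia.
have [m am] : exists m : int, a = 2 * m + n.
  exists ((a - n) %/ 2)%Z.
  have : odd (`|a| * `|a|) = odd (`|n| * `|n|) by lia.
  by rewrite !oddM !andbb; lia.
exists m, n; split.
  have -> : u = a%:~R / 2 by rewrite -ua; field.
  by rewrite am rmorphD rmorphM /=; field.
have -> : v = c%:~R / 10 by rewrite -vc; field.
by rewrite cn rmorphM /=; field.
Qed.

(** * Divisibility in Z[phi] *)

Lemma dvdz_prime_mul (p : nat) (a b : int) : prime p ->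
  (p %| a * b)%Z = (p %| a)%Z || (p %| b)%Z.
Proof. by move=> pp; rewrite !dvdzE abszM Euclid_dvdM. Qed.

Lemma squarefree_dvdn (a n : nat) : (0 < n)%N -> squarefree n ->
  (forall p, prime p -> (p %| n)%N -> (p %| a)%N) -> (n %| a)%N.
Proof.
move=> n0 sqf pa; apply/dvdn_partP => // p; rewrite mem_primes => /and3P[pp _ pn].
rewrite p_part (_ : logn p n = 1%N) ?expn1 ?pa //; apply/eqP.
rewrite eqn_leq logn_gt0 mem_primes pp n0 pn andbT leqNgt -pfactor_dvdn //.
by rewrite -mulnn sqf.
Qed.

Lemma squarefree_10M (k : nat) : odd k -> coprime k 5 -> squarefree k ->
  squarefree (10 * k).
Proof.
move=> ko k5 sqf p pp; apply/negP => ppk.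
have k5' : ~~ (5 %| k)%N by rewrite -prime_coprime // coprime_sym.
have [p2|p2] := eqVneq p 2; first by move: ppk; rewrite p2; lia.
have [p5|p5] := eqVneq p 5; first by move: ppk; rewrite p5; lia.
move: ppk; rewrite Gauss_dvdr; first by apply/negP/sqf.
have cp q : prime q -> p != q -> coprime p q.
  by move=> qp pq; rewrite prime_coprime // dvdn_prime2.
by rewrite -[10%N]/(2 * 5)%N coprimeMl coprimeMr !cp.
Qed.

(** The two dividends are the coordinates of (m + n phi)^2, and primes other than 5 are unramified
    in Z[phi]. Concretely, 5 n^3 is a combination of these coordinates. *)
Lemma golden_sqr_dvd (p : nat) (m n : int) : prime p -> p != 5%N ->
  (p %| m * m + n * n)%Z -> (p %| 2 * m * n + n * n)%Z ->
  (p %| m)%Z /\ (p %| n)%Z.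
Proof.
move=> pp p5 h1 h2.
have pn : (p %| n)%Z.
  have : (p %| 5 * (n * (n * n)))%Z.
    have -> : 5 * (n * (n * n)) =
      4 * n * (m * m + n * n) - (2 * m - n) * (2 * m * n + n * n) by ring.
    by rewrite rpredB // dvdz_mull.
  rewrite !dvdz_prime_mul // => /orP[|/or3P[] //].
  by rewrite dvdzE /= dvdn_prime2 // (negbTE p5).
split=> //; have : (p %| m * m)%Z.
  have -> : m * m = (m * m + n * n) - n * n by ring.
  by rewrite rpredB // dvdz_mull.
by rewrite dvdz_prime_mul // orbb.
Qed.

(* Taking norms, [(m + n phi)^2 = 10 k sqrt5 (x + y phi)] makes 125 divide the
   square of the norm of [m + n phi]. *)
Lemma golden_sqr_dvd5 (k m n x y : int) :
  m * m + n * n = 10 * k * (2 * y - x) ->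
  2 * m * n + n * n = 10 * k * (2 * x + y) ->
  (5 %| m)%Z /\ (5 %| n)%Z.
Proof.
move=> h1 h2.
pose N := m * m + m * n - n * n.
have eqN : N * N = 125 * (- 4 * (k * k) * (x * x + x * y - y * y)).
  have -> : N * N = (m * m + n * n) * (m * m + n * n)
     + (m * m + n * n) * (2 * m * n + n * n)
     - (2 * m * n + n * n) * (2 * m * n + n * n) by rewrite /N; ring.
  rewrite h1 h2; ring.
have [N1 eN1] : exists N1, N = 5 * N1.
  have : (5 %| N)%Z.
    have : (5%N %| N * N)%Z by rewrite eqN; apply/dvdz_mulr.
    by rewrite dvdz_prime_mul // orbb.
  by move=> /dvdzP[q ->]; exists q; rewrite mulrC.
have [N2 eN2] : exists N2, N1 = 5 * N2.
  have : (5 %| N1)%Z.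
    have : (5%N %| N1 * N1)%Z.
      move: eqN; rewrite eN1; move: (- 4 * _ * _) => Q e.
      by apply/dvdzP; exists Q; lia.
    by rewrite dvdz_prime_mul // orbb.
  by move=> /dvdzP[q ->]; exists q; rewrite mulrC.
(* Now 25 divides N. Completing the square gives 5 | 2m + n, then 25 | 5 n^2. *)
have eN : 4 * N = (2 * m + n) * (2 * m + n) - 5 * (n * n) by rewrite /N; ring.
have [t et] : exists t, 2 * m + n = 5 * t.
  have : (5 %| 2 * m + n)%Z.
    have : (5%N %| (2 * m + n) * (2 * m + n))%Z.
      by apply/dvdzP; exists (4 * N1 + n * n); lia.
    by rewrite dvdz_prime_mul // orbb.
  by move=> /dvdzP[q ->]; exists q; rewrite mulrC.
have n5 : (5 %| n)%Z.
  have : (5%N %| n * n)%Z.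
    apply/dvdzP; exists (t * t - 4 * N2).
    by move: eN; rewrite et eN1 eN2; lia.
  by rewrite dvdz_prime_mul // orbb.
by split=> //; lia.
Qed.

(** The hypotheses are the coordinates of (m + n phi)^2 = 10 k sqrt5 (x + y phi), with sqrt5 = 2 phi
    - 1. Each prime divisor of the squarefree number 10 k then divides m and n. *)
Lemma golden_dvd_10M (k : nat) (m n x y : int) : (0 < k)%N -> odd k ->
  coprime k 5 -> squarefree k ->
  m * m + n * n = 10 * k%:Z * (2 * y - x) ->
  2 * m * n + n * n = 10 * k%:Z * (2 * x + y) ->
  ((10 * k)%N %| m)%Z /\ ((10 * k)%N %| n)%Z.
Proof.
move=> k0 ko k5 sqf h1 h2.
have H p : prime p -> (p %| 10 * k)%N -> (p %| m)%Z /\ (p %| n)%Z.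
  move=> pp pk; have [p5|p5] := eqVneq p 5%N.
    by rewrite p5; exact: golden_sqr_dvd5 h1 h2.
  have pk' : (p %| 10 * k%:Z)%Z by rewrite dvdzE abszM.
  by apply: golden_sqr_dvd => //; rewrite ?h1 ?h2; exact: dvdz_mulr.
have k10 : (0 < 10 * k)%N by lia.
rewrite !dvdzE /=; split; apply: squarefree_dvdn => //;
  rewrite ?muln_gt0 //; try exact: squarefree_10M; move=> p pp /(H p pp)[].
  by rewrite dvdzE.
by rewrite !dvdzE.
Qed.

Lemma even_of_odd_mul (k : nat) (z w : int) :
  odd k -> k%:Z * z = 2 * w -> exists h : int, z = 2 * h.
Proof.
move=> ko e; exists (z %/ 2)%Z.
have : ~~ odd (k * `|z|) by rewrite -[k]/(`|k%:Z|%N) -abszM e; lia.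
by rewrite oddM ko /=; lia.
Qed.

Lemma even_of_sqr (z w : int) : z * z = 2 * w -> exists h : int, z = 2 * h.
Proof.
move=> e; exists (z %/ 2)%Z.
have : ~~ odd (`|z| * `|z|) by rewrite -abszM e; lia.
by rewrite oddM andbb /=; lia.
Qed.

(** With A = a + b phi and C = c + d phi, the hypotheses read A^2 - k (4 + 2 phi) C^2 = 4 (e + f
    phi), where 4 + 2 phi = 5 + sqrt5. As 2 is inert, A is even; dividing by 2, k (2 + phi) C^2 is
    even, and k and the norm 5 of 2 + phi are odd, so C is even. *)
Lemma golden_even (k : nat) (a b c d e f : int) : odd k ->
  a * a + b * b - k%:Z * (4 * (c * c + d * d) + 2 * (2 * c * d + d * d)) = 4 * e ->
  2 * a * b + b * b - k%:Z * (2 * (c * c + d * d) + 6 * (2 * c * d + d * d)) = 4 * f ->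
  exists a' b' c' d' : int, [/\ a = 2 * a', b = 2 * b', c = 2 * c' & d = 2 * d'].
Proof.
move=> ko h1 h2.
have [b' eb] : exists h : int, b = 2 * h.
  apply: (@even_of_sqr b
    (2 * f + k%:Z * (c * c + d * d + 3 * (2 * c * d + d * d)) - a * b)).
  lia.
have [a' ea] : exists h : int, a = 2 * h.
  apply: (@even_of_sqr a
    (2 * e - b' * b + k%:Z * (2 * (c * c + d * d) + (2 * c * d + d * d)))).
  by rewrite eb in h1 *; lia.
subst a b.
have [Y eY] : exists h : int, 2 * c * d + d * d = 2 * h.
  apply: (@even_of_odd_mul k _ (a' * a' + b' * b' - e - k%:Z * (c * c + d * d))) => //.
  lia.
have [d' ed] : exists h : int, d = 2 * h by apply: (@even_of_sqr d (Y - c * d)); lia.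
have [Z eZ] : exists h : int, c * c + d * d + 3 * (2 * c * d + d * d) = 2 * h.
  apply: (@even_of_odd_mul k _ (2 * a' * b' + b' * b' - f)) => //; lia.
have [c' ec] : exists h : int, c = 2 * h.
  by apply: (@even_of_sqr c (Z - d' * d - 3 * Y)); rewrite ed in eY eZ *; lia.
by exists a', b', c', d'.
Qed.

(** * The ring of integers of K *)

Lemma Aint_beta' k : coprime k 5 -> beta' k \in Aint.
Proof.
move=> k5; have := @Aint_conj (beta k) (beta' k) 'X; rewrite !map_polyX !hornerX.
by apply; rewrite ?Aint_beta // root_minCpoly_beta // !inE eqxx !orbT.
Qed.

(** Write the element as (A + C beta) / 2 with A and C in Q(sqrt5). The relative trace puts A in
    Z[phi], divisibility by 10 k puts C there, and the relative norm shows that both are even. *)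
Lemma ring_of_integers (k : nat) (p : {poly rat}) : (0 < k)%N -> odd k ->
  coprime k 5 -> squarefree k -> ev p (beta k) \in Aint ->
  exists a b c d : int, ev p (beta k) =
    (a%:~R + b%:~R * phi) + (c%:~R + d%:~R * phi) * beta k.
Proof.
move=> k0 ko k5 sqf pA.
have [u [v [w [z evp]]]] := ev_coords k p.
have s2 := sqr_sqrt5.
have s2' : (- sqrt5) ^+ 2 = 5 by rewrite sqrrN.
have b2 := sqr_beta k; have b2' := sqr_beta' k.
have conjA r : r \in conjs k -> ev p r \in Aint.
  by move=> rk; apply: (Aint_conj _ pA); rewrite root_minCpoly_beta.
have e1 := evp _ _ s2 b2.
have e2 := evp _ (- beta k) s2; rewrite sqrrN in e2; have {}e2 := e2 b2.
have e3 := evp _ _ s2' b2'.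
have e4 := evp _ (- beta' k) s2'; rewrite sqrrN in e4; have {}e4 := e4 b2'.
have A1 := pA.
have A2 : ev p (- beta k) \in Aint by apply: conjA; rewrite !inE eqxx ?orbT.
have A3 : ev p (beta' k) \in Aint by apply: conjA; rewrite !inE eqxx ?orbT.
have A4 : ev p (- beta' k) \in Aint by apply: conjA; rewrite !inE eqxx ?orbT.
rewrite e1; rewrite {}e1 in A1; rewrite {}e2 in A2; rewrite {}e3 in A3.
rewrite {}e4 in A4.
move=> {evp conjA pA}.
have subA (x y : algC) : x \in Aint -> y = x -> y \in Aint by move=> ? ->.
have kQ : k%:R != 0 :> rat by rewrite pnatr_eq0 -lt0n.
have kC : k%:R != 0 :> algC by rewrite pnatr_eq0 -lt0n.
have iN (i : nat) : (i%:R : int)%:~R = i%:R :> rat by rewrite rmorph_nat.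
have iM (i j : int) : (i * j)%:~R = i%:~R * j%:~R :> rat by exact: intrM.
have iD (i j : int) : (i + j)%:~R = i%:~R + j%:~R :> rat by exact: intrD.
have iB (i j : int) : (i - j)%:~R = i%:~R - j%:~R :> rat by exact: intrB.
(* Relative traces: sums of the values at beta and -beta, and at beta' and -beta'. *)
have [m [n [eU eV]]] : exists m n : int, 2 * u = m%:~R + n%:~R / 2 /\ 2 * v = n%:~R / 2.
  apply: ring_of_integers_sqrt5.
    apply: (subA _ _ (rpredD A1 A2)).
    by rewrite !ratrM !ratr_nat; ring.
  apply: (subA _ _ (rpredD A3 A4)).
  by rewrite !ratrM !ratr_nat; ring.
(* With C = 2 (w + z sqrt5), [(5 + sqrt5) (3 - phi) = 10] puts 10 k C in Z[phi],
   and [(5 + sqrt5) (phi - 1) = 2 sqrt5] puts 2 k sqrt5 C^2 in Z[phi]. *)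
have [m1 [n1 [em1 en1]]] : exists m n : int,
  10 * k%:R * (2 * w) = m%:~R + n%:~R / 2 /\ 10 * k%:R * (2 * z) = n%:~R / 2.
  apply: ring_of_integers_sqrt5.
    have : 3 - phi \in Aint by apply: rpredB Aint_phi; exact: rpred_nat.
    move=> /(rpredM (rpredM (rpredB A1 A2) (Aint_beta k))) h; apply: (subA _ _ h).
    by rewrite !ratrM !ratr_nat /phi; field: s2 b2.
  have : 2 + phi \in Aint by apply: rpredD Aint_phi; exact: rpred_nat.
  move=> /(rpredM (rpredM (rpredB A3 A4) (Aint_beta' k5))) h; apply: (subA _ _ h).
  by rewrite !ratrM !ratr_nat /phi; field: s2 b2'.
have [x [y [ex ey]]] : exists m n : int,
  20 * k%:R * ((2 * w) * (2 * z)) = m%:~R + n%:~R / 2 /\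
  2 * k%:R * ((2 * w) * (2 * w) + 5 * ((2 * z) * (2 * z))) = n%:~R / 2.
  apply: ring_of_integers_sqrt5.
    have : phi - 1 \in Aint by apply: rpredB Aint_phi _; exact: rpred1.
    move=> /(rpredM (rpredM (rpredB A1 A2) (rpredB A1 A2))) h; apply: (subA _ _ h).
    by rewrite !(ratr_nat, ratrM, ratrD) /phi; field: s2 b2.
  have : - phi \in Aint by rewrite rpredN Aint_phi.
  move=> /(rpredM (rpredM (rpredB A3 A4) (rpredB A3 A4))) h; apply: (subA _ _ h).
  by rewrite !(ratr_nat, ratrM, ratrD) /phi; field: s2 b2'.
have [eW eZ] : 2 * w = (m1%:~R + n1%:~R / 2) / (10 * k%:R) /\
    2 * z = (n1%:~R / 2) / (10 * k%:R).
  by rewrite -em1 -en1; split; field.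
(* [rel1] and [rel2] are the coordinates of (10 k C)^2 = 10 k sqrt5 (2 k sqrt5 C^2). *)
have rel1 : m1 * m1 + n1 * n1 = 10 * k%:Z * (2 * y - x).
  apply: (intr_inj (R := rat)).
  have {}ey : y%:~R = 2 * (2 * k%:R * (2 * w * (2 * w) + 5 * (2 * z * (2 * z)))).
    by rewrite ey; field.
  have {}ex : x%:~R = 20 * k%:R * (2 * w * (2 * z)) - y%:~R / 2.
    by rewrite ex; field.
  rewrite !(iN, iM, iB, iD) ex ey eW eZ.
  by field.
have rel2 : 2 * m1 * n1 + n1 * n1 = 10 * k%:Z * (2 * x + y).
  apply: (intr_inj (R := rat)).
  have {}ey : y%:~R = 2 * (2 * k%:R * (2 * w * (2 * w) + 5 * (2 * z * (2 * z)))).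
    by rewrite ey; field.
  have {}ex : x%:~R = 20 * k%:R * (2 * w * (2 * z)) - y%:~R / 2.
    by rewrite ex; field.
  rewrite !(iN, iM, iB, iD) ex ey eW eZ.
  by field.
have [/dvdzP[c ec] /dvdzP[d ed]] := golden_dvd_10M k0 ko k5 sqf rel1 rel2.
have {}eW : 2 * w = c%:~R + d%:~R / 2.
  rewrite eW ec ed !iM; rewrite -[((10 * k)%N)%:~R]/((10 * k)%:R) natrM; by field.
have {}eZ : 2 * z = d%:~R / 2.
  rewrite eZ ed !iM; rewrite -[((10 * k)%N)%:~R]/((10 * k)%:R) natrM; by field.
(* The relative norm is (A^2 - k (5 + sqrt5) C^2) / 4, with A = 2 (u + v sqrt5). *)
have [e [f [ee ef]]] : exists e f : int,
   ((2 * u) * (2 * u) + 5 * ((2 * v) * (2 * v))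
    - k%:R * (5 * ((2 * w) * (2 * w) + 5 * ((2 * z) * (2 * z)))
              + 10 * ((2 * w) * (2 * z)))) / 4 = e%:~R + f%:~R / 2 /\
   (2 * ((2 * u) * (2 * v)) - k%:R * ((2 * w) * (2 * w) + 5 * ((2 * z) * (2 * z))
              + 10 * ((2 * w) * (2 * z)))) / 4 = f%:~R / 2.
  have r4 : ratr 4^-1 = 4^-1 :> algC by rewrite fmorphV /= ratr_nat.
  apply: ring_of_integers_sqrt5.
    apply: (subA _ _ (rpredM A1 A2)).
    rewrite !(r4, ratr_nat, ratrM, ratrB, ratrD); by field: s2 b2.
  apply: (subA _ _ (rpredM A3 A4)).
  rewrite !(r4, ratr_nat, ratrM, ratrB, ratrD); by field: s2 b2'.
have {}ef : f%:~R = (2 * ((2 * u) * (2 * v)) - k%:R * ((2 * w) * (2 * w)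
    + 5 * ((2 * z) * (2 * z)) + 10 * ((2 * w) * (2 * z)))) / 2.
  by move: ef; lra.
have [a' [b' [c' [d' [ea eb ec' ed']]]]] :
  exists a' b' c' d' : int, [/\ m = 2 * a', n = 2 * b', c = 2 * c' & d = 2 * d'].
  apply: (@golden_even k _ _ _ _ e f) => //.
    apply: (intr_inj (R := rat)).
    have {}ee : e%:~R = ((2 * u) * (2 * u) + 5 * ((2 * v) * (2 * v))
    - k%:R * (5 * ((2 * w) * (2 * w) + 5 * ((2 * z) * (2 * z)))
              + 10 * ((2 * w) * (2 * z)))) / 4 - f%:~R / 2 by rewrite ee; ring.
    rewrite !(iN, iM, iB, iD) ee ef eW eZ eU eV.
    by field.
  apply: (intr_inj (R := rat)).
  rewrite !(iN, iM, iB, iD) ef eW eZ eU eV.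
  by field.
have halve (q : rat) (i j : int) : 2 * q = (2 * i)%:~R + (2 * j)%:~R / 2 ->
    ratr q = i%:~R + j%:~R / 2 :> algC.
  move=> h; have -> : q = i%:~R + j%:~R * 2^-1 by move: h; rewrite !(iN, iM); lra.
  by rewrite ratrD ratrM !ratr_int fmorphV /= ratr_nat.
exists a', b', c', d'.
rewrite (halve u a' b') -?ea -?eb // (halve w c' d') -?ec' -?ed' //.
rewrite (halve v 0 b') -?eb ?mulr0 ?add0r // (halve z 0 d') -?ed' ?mulr0 ?add0r //.
by rewrite /phi; field.
Qed.

(** * The discriminant *)

(** Entries are indexed by [nat], so that those of nested minors reduce by computation. *)
Lemma det_mx33 (R : comNzRingType) (f : nat -> nat -> R) :
  \det (\matrix_(i < 3, j < 3) f i j) =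
  f 0 0 * (f 1 1 * f 2 2 - f 1 2 * f 2 1)
  - f 0 1 * (f 1 0 * f 2 2 - f 1 2 * f 2 0)
  + f 0 2 * (f 1 0 * f 2 1 - f 1 1 * f 2 0).
Proof.
rewrite (expand_det_row _ ord0) !big_ord_recl big_ord0 /cofactor.
rewrite !(expand_det_row _ ord0) !big_ord_recl !big_ord0 /cofactor.
by rewrite !det_mx11 !mxE /=; ring.
Qed.

Lemma det_mx44 (R : comNzRingType) (f : nat -> nat -> R) :
  \det (\matrix_(i < 4, j < 4) f i j) =
  \sum_(j < 4) f 0 j *
    ((-1) ^+ j * \det (\matrix_(i < 3, l < 3) f i.+1 (bump j l))).
Proof.
rewrite (expand_det_row _ ord0); apply: eq_bigr => j _; rewrite mxE /cofactor.
by congr (_ * (_ * \det _)); apply/matrixP => i l; rewrite !mxE.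
Qed.

(** The images of 1, phi, beta, phi beta when phi goes to [f] and beta to [r]. The ring is left
    general to allow both numbers and polynomials. *)
Definition basis_val (R : nzRingType) (f r : R) : seq R := [:: 1; f; r; f * r].

Lemma det_basis_val (R : comNzRingType) (f f' b b' : R) :
  let F := [:: (f, b); (f, - b); (f', b'); (f', - b')] in
  \det (\matrix_(i < 4, j < 4)
     (let x := nth (0, 0) F i in (basis_val x.1 x.2)`_j)) =
  - 4 * b * b' * (f - f') ^+ 2.
Proof.
move=> F; pose G i j := (let x := nth (0, 0) F i in (basis_val x.1 x.2)`_j).
rewrite -/G (det_mx44 G) !big_ord_recl big_ord0.
rewrite !(det_mx33 (fun i l => G i.+1 (bump _ l))) /G /=.
by ring.
Qed.

(** Uses phi = beta^2 / (2k) - 2. *)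
Definition basis_poly (k : nat) : seq {poly rat} :=
  basis_val ((2 * k%:R)^-1 *: 'X^2 - 2%:P) 'X.

Lemma ev_basis_poly k (s r : algC) (j : nat) : (0 < k)%N ->
  r ^+ 2 = k%:R * (5 + s) ->
  ev (basis_poly k)`_j r = (basis_val ((1 + s) / 2) r)`_j.
Proof.
move=> k0 r2; have k0' : k%:R != 0 :> algC by rewrite pnatr_eq0 -lt0n.
have phiE : ev ((2 * k%:R)^-1 *: 'X^2 - 2%:P) r = (1 + s) / 2.
  rewrite rmorphB /= map_polyZ map_polyXn map_polyC /= fmorphV rmorphM /= !ratr_nat.
  by rewrite hornerD hornerN hornerZ hornerXn hornerC r2; field.
case: j => [|[|[|[|j]]]] /=; rewrite ?map_polyX ?hornerX ?rmorph0 ?horner0 //.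
- by rewrite rmorph1 hornerC.
- by rewrite rmorphM hornerM phiE /= map_polyX hornerX.
- by rewrite !nth_nil rmorph0 horner0.
Qed.

(** The order of the conjugates in [rs] is arbitrary, but it only permutes rows and so affects the
    sign alone. The value is 4 beta beta' (phi - phi')^2 = 4 (2 k sqrt5) 5. *)
Lemma det_basis_conjs (k : nat) (rs : 'I_4 -> algC) : (0 < k)%N ->
  perm_eq (codom rs) (conjs k) ->
  `|\det (\matrix_(i, j < 4) ev (basis_poly k)`_j (rs i))| = 40 * k%:R * sqrt5.
Proof.
move=> k0; pose t : 4.-tuple algC := [tuple beta k; - beta k; beta' k; - beta' k].
rewrite -[conjs k]/(tval t) => /tuple_permP[s rsE].
have {}rsE i : rs i = (conjs k)`_(s i).
  have := congr1 (fun u => u`_i) rsE; rewrite /codom /image_mem /=.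
  rewrite (nth_map i) ?size_enum_ord // nth_ord_enum => ->.
  by rewrite (nth_map i) ?size_enum_ord // nth_ord_enum (tnth_nth 0).
pose F := [:: (phi, beta k); (phi, - beta k); (phi', beta' k); (phi', - beta' k)].
pose M := \matrix_(i < 4, j < 4)
  (let x := nth (0, 0) F i in (basis_val x.1 x.2)`_j).
have -> : \matrix_(i, j < 4) ev (basis_poly k)`_j (rs i) = row_perm s M.
  apply/matrixP => i j; rewrite !mxE rsE.
  case: (s i) => [[|[|[|[|//]]]] /= _].
  - by rewrite (ev_basis_poly _ k0 (sqr_beta k)).
  - by rewrite (@ev_basis_poly k sqrt5) // sqrrN sqr_beta.
  - by rewrite (@ev_basis_poly k (- sqrt5)) // sqr_beta'.
  - by rewrite (@ev_basis_poly k (- sqrt5)) // sqrrN sqr_beta'.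
rewrite row_permE det_mulmx det_perm normrM normr_sign mul1r.
rewrite (det_basis_val phi phi' (beta k) (beta' k)).
have -> : - 4 * beta k * beta' k * (phi - phi') ^+ 2 = - (40 * k%:R * sqrt5).
  rewrite -[_ * _ * beta' k]mulrA beta_mul /phi /phi'.
  by field: sqr_sqrt5.
by rewrite normrN ger0_norm // !mulr_ge0 // sqrt5_ge0.
Qed.

Lemma ev_int_comb n (P : 'I_n -> {poly rat}) (z : 'I_n -> int) (x : algC) :
  ev (\sum_j (z j)%:~R *: P j) x = \sum_j ev (P j) x * (z j)%:~R.
Proof.
rewrite rmorph_sum horner_sum; apply: eq_bigr => j _ /=.
by rewrite map_polyZ hornerZ /= ratr_int mulrC.
Qed.

(* An integral relation between values at [x] survives at every conjugate of
   [x], hence becomes a matrix identity. *)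
Lemma conj_int_mx n (x : algC) (rs : 'I_n -> algC) (P Q : 'I_n -> {poly rat}) :
  (forall i, root (minCpoly x) (rs i)) ->
  (forall j, exists z : 'I_n -> int, ev (Q j) x = \sum_l (z l)%:~R * ev (P l) x) ->
  exists Z : 'M[int]_n, \matrix_(i, j) ev (Q j) (rs i) =
    \matrix_(i, j) ev (P j) (rs i) *m map_mx intr Z.
Proof.
move=> rsP /fin_all_exists[z zP]; exists (\matrix_(l, j) z j l).
apply/matrixP => i j; rewrite !mxE.
under eq_bigr do rewrite !mxE.
rewrite -ev_int_comb; apply/eqP; rewrite -subr_eq0 -hornerN -hornerD -rmorphN -rmorphD.
apply/eqP/(root_minCpoly_conj (rsP i)).
rewrite rmorphD rmorphN hornerD hornerN /= ev_int_comb zP.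
by apply/eqP; rewrite subr_eq0; apply/eqP/eq_bigr => l _; rewrite mulrC.
Qed.

(** The two integer determinants have product 1, so each is a unit of the integers. *)
Lemma intmx_det_norm n (A B : 'M[algC]_n) (Z Z' : 'M[int]_n) :
  A = B *m map_mx intr Z -> B = A *m map_mx intr Z' -> \det A != 0 ->
  `|\det B| = `|\det A|.
Proof.
move=> /(congr1 determinant) eA /(congr1 determinant) eB A0.
rewrite !det_mulmx !det_map_mx in eA eB.
have ZZ : \det Z * \det Z' = 1.
  apply: (intr_inj (R := algC)); apply: (mulfI A0).
  by rewrite mulr1 rmorphM /= mulrCA -eB mulrC -eA.
have uZ : `|\det Z'| = 1 :> int.
  have := congr1 absz ZZ; rewrite abszM => /eqP.
  rewrite muln_eq1 => /andP[_ /eqP]; rewrite -abszE => ->//.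
by rewrite eB normrM -intr_norm uZ mulr1.
Qed.

(** The given basis and 1, phi, beta, phi beta are integer combinations of each other, at beta and
    hence at every conjugate. *)
Lemma sqrt_abs_disc (k : nat) (D : algC) : (0 < k)%N -> odd k ->
  coprime k 5 -> squarefree k -> abs_disc (beta k) D ->
  sqrtC D = 40 * k%:R * sqrt5.
Proof.
move=> k0 ko k5 sqf [n [rs [P /= [minP [BA [span [_ ->]]]]]]].
have prodE : minCpoly (beta k) = \prod_(r <- codom rs) ('X - r%:P).
  by rewrite minP /codom big_map big_enum.
have pe : perm_eq (codom rs) (conjs k).
  by apply: prod_XsubC_eq; rewrite -prodE minCpoly_beta.
have n4 : n = 4.
  by have := perm_size pe; rewrite size_codom card_ord.
subst n.
have rsP i : root (minCpoly (beta k)) (rs i).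
  by rewrite prodE root_prod_XsubC codom_f.
have detE := det_basis_conjs k0 pe.
set MB := (X in \det X); set ME := (X in \det X) in detE.
have [Z eZ] : exists Z : 'M[int]_4, ME = MB *m map_mx intr Z.
  apply: (conj_int_mx rsP) => j; apply: span; split; first by exists (basis_poly k)`_j.
  rewrite (ev_basis_poly _ k0 (sqr_beta k)) -/phi.
  case: j => [[|[|[|[|//]]]] _] /=.
  - exact: Aint1.
  - exact: Aint_phi.
  - exact: Aint_beta.
  - exact: rpredM Aint_phi (Aint_beta k).
have [Z' eZ'] : exists Z : 'M[int]_4, MB = ME *m map_mx intr Z.
  apply: (conj_int_mx rsP) => j.
  have [a [b [c [d ->]]]] := ring_of_integers k0 ko k5 sqf (BA j).
  exists (fun i => [:: a; b; c; d]`_i).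
  rewrite !big_ord_recl big_ord0 !(ev_basis_poly _ k0 (sqr_beta k)) -/phi /=.
  by ring.
have detE0 : \det ME != 0.
  rewrite -normr_gt0 detE !mulr_gt0 ?ltr0n //.
  exact: lt_trans sqrt5_gt2.
by rewrite (intmx_det_norm eZ eZ' detE0) detE sqrCK // -detE.
Qed.

(** * Mahler measure and the lower bound *)

(** This is max(1, |r|), in the shape that [big_mkcond] gives to a filtered product. *)
Definition mahler_factor (r : algC) : algC := if 1 <= `|r| then `|r| else 1.

Lemma mahler_factor_ge1 r : 1 <= mahler_factor r.
Proof. by rewrite /mahler_factor; case: ifP. Qed.

Lemma le_mahler_factor r : `|r| <= mahler_factor r.
Proof.
rewrite /mahler_factor; case: ifP => // /negbT.
by rewrite -real_ltNge ?normr_real ?real1 // => /ltW.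
Qed.

Lemma mahler_factor_le (r x : algC) : 1 <= x -> `|r| <= x -> mahler_factor r <= x.
Proof. by rewrite /mahler_factor; case: ifP. Qed.

Lemma prod_mahler_factor rs :
  \prod_(r <- rs | 1 <= `|r|) `|r| = \prod_(r <- rs) mahler_factor r.
Proof. exact: big_mkcond. Qed.

Lemma prod_mahler_factor_ge1 rs : 1 <= \prod_(r <- rs) mahler_factor r.
Proof.
elim: rs => [|r rs IH]; first by rewrite big_nil.
by rewrite big_cons mulr_ege1 ?mahler_factor_ge1.
Qed.

(** All factors are at least 1, so a lower bound on M(a) only needs some distinct roots of the
    polynomial. *)
Lemma prod_mahler_factor_sub (s rs : seq algC) :
  uniq s -> {subset s <= rs} ->
  \prod_(r <- s) mahler_factor r <= \prod_(r <- rs) mahler_factor r.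
Proof.
elim: s rs => [|x s IH] rs /= => [_ _|/andP[xs us] srs].
  by rewrite big_nil prod_mahler_factor_ge1.
have /perm_to_rem pe : x \in rs by rewrite srs ?mem_head.
rewrite (perm_big _ pe) !big_cons ler_wpM2l //.
  exact: le_trans (mahler_factor_ge1 x).
apply: IH => // y ys.
have : y \in rs by rewrite srs // inE ys orbT.
by rewrite (perm_mem pe) inE => /orP[/eqP yx|//]; rewrite -yx ys in xs.
Qed.

Lemma dist_le_mahler_factor (x y : algC) :
  `|x - y| / 2 <= mahler_factor x * mahler_factor y.
Proof.
have g0 r : 0 <= mahler_factor r by exact: le_trans (mahler_factor_ge1 r).
rewrite ler_pdivrMr // mulr_natr mulr2n (le_trans (ler_normB _ _)) // lerD //.
  rewrite (le_trans (le_mahler_factor x)) // ler_peMr ?mahler_factor_ge1 //.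
rewrite (le_trans (le_mahler_factor y)) // ler_peMl ?mahler_factor_ge1 //.
Qed.

Lemma ring_of_integers_conj (k : nat) (p : {poly rat}) : (0 < k)%N -> odd k ->
  coprime k 5 -> squarefree k -> ev p (beta k) \in Aint ->
  exists a b c d : int, forall s r, r \in conjs k -> r ^+ 2 = k%:R * (5 + s) ->
    ev p r = (a%:~R + b%:~R * ((1 + s) / 2)) + (c%:~R + d%:~R * ((1 + s) / 2)) * r.
Proof.
move=> k0 ko k5 sqf pA.
have [a [b [c [d pE]]]] := ring_of_integers k0 ko k5 sqf pA.
exists a, b, c, d => s r rk r2.
pose q := \sum_(j < 4) ([:: a; b; c; d]`_j)%:~R *: (basis_poly k)`_j.
have qE s' r' : r' ^+ 2 = k%:R * (5 + s') -> ev q r' =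
    (a%:~R + b%:~R * ((1 + s') / 2)) + (c%:~R + d%:~R * ((1 + s') / 2)) * r'.
  move=> r2'; rewrite ev_int_comb !big_ord_recl big_ord0.
  by rewrite !(ev_basis_poly _ k0 r2') /=; ring.
rewrite -qE //; apply/eqP; rewrite -subr_eq0 -hornerN -hornerD -rmorphN -rmorphD.
apply/eqP/(@root_minCpoly_conj (beta k)); first by rewrite root_minCpoly_beta.
rewrite rmorphD rmorphN hornerD hornerN /= pE (qE _ _ (sqr_beta k)).
by rewrite subrr.
Qed.

(** If beta = q(p(beta)), then q(p(r)) = r at every conjugate r, so p is injective on conjugates. *)
Lemma same_field_conj_uniq k (p : {poly rat}) : (0 < k)%N -> coprime k 5 ->
  in_Qgen (ev p (beta k)) (beta k) -> uniq [seq ev p r | r <- conjs k].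
Proof.
move=> k0 k5 [q bE].
have qp r : r \in conjs k -> ev q (ev p r) = r.
  rewrite -root_minCpoly_beta // => rr; rewrite -ev_comp; apply/eqP.
  rewrite -subr_eq0 -[X in _ - X](hornerX r) -(map_polyX (ratr : rat -> algC)).
  rewrite -hornerN -hornerD -rmorphN -rmorphD; apply/eqP/(root_minCpoly_conj rr).
  by rewrite rmorphD rmorphN hornerD hornerN /= ev_comp -bE map_polyX hornerX subrr.
rewrite map_inj_in_uniq ?conjs_uniq // => x y xk yk e.
by rewrite -(qp x) // e qp.
Qed.

Lemma alg_mahler_ge (k : nat) (a m : algC) : (0 < k)%N -> odd k ->
  coprime k 5 -> squarefree k -> in_OK (beta k) a -> same_field (beta k) a ->
  alg_mahler a m -> 2 * k%:R * sqrt5 <= m.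
Proof.
move=> k0 ko k5 sqf [[p ->] pA] [_ ba] [f [[c [c0 [fE _]]] [rs [fP mE]]]].
have lcf : lead_coef f = c%:R.
  by rewrite fE lead_coefZ (monicP (minCpoly_monic _)) mulr1.
have mge : \prod_(r <- rs) mahler_factor r <= m.
  rewrite mE prod_mahler_factor lcf ler_peMl ?normr_nat ?ler1n //.
  exact: le_trans (prod_mahler_factor_ge1 _).
have sub : {subset [seq ev p r | r <- conjs k] <= rs}.
  move=> x /mapP[r rk ->]; rewrite -root_prod_XsubC.
  have c0' : c%:R != 0 :> algC by rewrite pnatr_eq0 -lt0n.
  rewrite -(rootZ _ _ c0') -lcf -fP fE rootZ //.
  by apply: root_minCpoly_ev; rewrite root_minCpoly_beta.
have uniqa := same_field_conj_uniq k0 k5 ba.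
apply: le_trans (le_trans (prod_mahler_factor_sub uniqa sub) mge).
have [x [y [z [t pE]]]] := ring_of_integers_conj k0 ko k5 sqf pA.
have memc i : (i < 4)%N -> (conjs k)`_i \in conjs k by move=> ?; rewrite mem_nth.
have e1 := pE sqrt5 _ (memc 0%N isT) (sqr_beta k).
have e2 := pE sqrt5 _ (memc 1%N isT); rewrite sqrrN in e2; have {}e2 := e2 (sqr_beta k).
have e3 := pE (- sqrt5) _ (memc 2%N isT) (sqr_beta' k).
have e4 := pE (- sqrt5) _ (memc 3%N isT);
  rewrite sqrrN in e4; have {}e4 := e4 (sqr_beta' k).
rewrite /= in e1 e2 e3 e4.
move: uniqa; rewrite /= !inE !negb_or => /and4P[/and3P[n12 _ _] _ n34 _].
rewrite !big_cons big_nil mulr1 mulrA.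
set x1 := ev p (beta k) in e1 n12 *; set x2 := ev p (- beta k) in e2 n12 *.
set x3 := ev p (beta' k) in e3 n34 *; set x4 := ev p (- beta' k) in e4 n34 *.
apply: le_trans (ler_pM _ _ (dist_le_mahler_factor x1 x2) (dist_le_mahler_factor x3 x4));
  rewrite ?divr_ge0 //.
(* The norm of the coefficient z + t phi of beta. *)
pose N := z * z + z * t - t * t.
have NE : (x1 - x2) * (x3 - x4) = N%:~R * (8 * k%:R * sqrt5).
  transitivity (4 * (beta k * beta' k) * ((z%:~R + t%:~R * ((1 + sqrt5) / 2))
        * (z%:~R + t%:~R * ((1 - sqrt5) / 2)))).
    by rewrite e1 e2 e3 e4; ring.
  by rewrite beta_mul /N; field: sqr_sqrt5.
(* N = 0 would make two of the conjugates of [a] coincide. *)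
have N1 : 1 <= `|N%:~R : algC|.
  rewrite norm_intr_ge1 // ?intr_int // intr_eq0; apply: contra_eq_neq NE => ->.
  by rewrite mul0r mulf_neq0 // subr_eq0.
have s0 := sqrt5_ge0.
have -> : `|x1 - x2| / 2 * (`|x3 - x4| / 2) = `|N%:~R| * (2 * k%:R * sqrt5).
  rewrite mulrACA -normrM NE normrM [`|8 * _ * _|]ger0_norm ?mulr_ge0 //.
  by field.
by rewrite ler_peMl // ?mulr_ge0.
Qed.

(** * Field operations in Q(x) *)

Lemma in_Qgen_rat (x : algC) (q : rat) : in_Qgen x (ratr q).
Proof. by exists q%:P; rewrite map_polyC hornerC. Qed.

Lemma in_Qgen_id (x : algC) : in_Qgen x x.
Proof. by exists 'X; rewrite map_polyX hornerX. Qed.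

Lemma in_QgenD (x y z : algC) : in_Qgen x y -> in_Qgen x z -> in_Qgen x (y + z).
Proof. by move=> [p ->] [q ->]; exists (p + q); rewrite rmorphD hornerD. Qed.

Lemma in_QgenM (x y z : algC) : in_Qgen x y -> in_Qgen x z -> in_Qgen x (y * z).
Proof. by move=> [p ->] [q ->]; exists (p * q); rewrite rmorphM hornerM. Qed.

(** If p(x) is nonzero, p is coprime to the minimal polynomial q, and a Bezout relation u p + v q =
    1 evaluated at x gives the inverse u(x). *)
Lemma in_QgenV (x y : algC) : in_Qgen x y -> in_Qgen x y^-1.
Proof.
move=> [p ->]; have [->|px0] := eqVneq (ev p x) 0.
  by rewrite invr0 -(rmorph0 (ratr : {rmorphism rat -> algC})); exact: in_Qgen_rat.
have [q [eq qm] qP] := minCpolyP x.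
have q0 : q != 0 by exact: monic_neq0.
have qx : ev q x = 0 by apply/rootP; rewrite -eq root_minCpoly.
have : coprimep p q.
  set g := gcdp p q; have gp : g %| p by exact: dvdp_gcdl.
  have /dvdpP[h qh] : g %| q by exact: dvdp_gcdr.
  have gx : ~~ root (map_poly ratr g) x.
    by rewrite qP; apply: contra px0 => /dvdp_trans/(_ gp); rewrite -qP.
  have : q %| h.
    rewrite -qP; move: qx; rewrite qh rmorphM hornerM => /eqP.
    by rewrite mulf_eq0 => /orP[//|gx0]; rewrite /root gx0 in gx.
  have h0 : h != 0 by apply: contraNneq q0 => h0; rewrite qh h0 mul0r.
  have g0 : g != 0 by apply: contraNneq q0 => g0; rewrite qh g0 mulr0.
  move=> /(dvdp_leq h0); rewrite {1}qh size_mul // /coprimep -/g.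
  rewrite -size_poly_gt0 in h0; rewrite -size_poly_gt0 in g0.
  have key a b : (0 < a -> 0 < b -> (a + b).-1 <= a -> b == 1)%N by lia.
  exact: key h0 g0.
move=> /Bezout_eq1_coprimepP[[u v] /= uv]; exists u.
apply: (mulfI px0); rewrite mulfV //.
have := congr1 (fun f => ev f x) uv.
by rewrite rmorphD !rmorphM hornerD !hornerM qx mulr0 addr0 rmorph1 hornerC mulrC.
Qed.

Lemma in_QgenN (x y : algC) : in_Qgen x y -> in_Qgen x (- y).
Proof. by move=> [p ->]; exists (- p); rewrite rmorphN hornerN. Qed.

(** * An integer of small Mahler measure *)

(** Round the half difference and the half sum separately: n s / 2 is within s/4 of (u - v)/2, and m
    + n/2 is within 1/2 of (u + v)/2. Both errors are then at most 1/2 + 9/16. *)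
Lemma golden_round (R : archiRealFieldType) (s u v : R) :
  0 < s -> s <= 9 / 4 -> exists m n : int,
  `|m%:~R + n%:~R * ((1 + s) / 2) - u| <= 3 / 2 /\
  `|m%:~R + n%:~R * ((1 - s) / 2) - v| <= 3 / 2.
Proof.
move=> s0 s9.
pose n := Num.floor ((u - v) / s + 1 / 2).
pose m := Num.floor ((u + v) / 2 - n%:~R / 2 + 1 / 2).
have [/andP[n1 n2] /andP[m1 m2]] :=
  (floor_itv ((u - v) / s + 1 / 2), floor_itv ((u + v) / 2 - n%:~R / 2 + 1 / 2)).
rewrite -/n -/m !rmorphD /= in n1 n2 m1 m2.
rewrite -lerBlDr ler_pdivlMr // in n1; rewrite -ltrBrDr ltr_pdivrMr // in n2.
exists m, n; move: m1 m2 n1 n2; move: (m%:~R) (n%:~R) => {}m {}n m1 m2 n1 n2.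
rewrite !ler_norml; split; apply/andP; split; nra.
Qed.

(** The rounding takes place in the real field [algR] and is carried back to [algC] by [algRval]. *)
Lemma golden_round_beta (k : nat) : (0 < k)%N -> exists m n : int,
  `|m%:~R + n%:~R * phi - beta k| <= 3 / 2 /\
  `|m%:~R + n%:~R * phi' - beta' k| <= 3 / 2.
Proof.
move=> k0.
pose s : algR := in_algR (ger0_real sqrt5_ge0).
pose u : algR := in_algR (gtr0_real (beta_gt0 k0)).
pose v : algR := in_algR (gtr0_real (beta'_gt0 k0)).
have [|| m [n [h1 h2]]] := @golden_round algR s u v.
- exact: lt_trans sqrt5_gt2.
- have -> : s <= 9 / 4 = (sqrt5 <= algRval (9 / 4)) by [].
  by rewrite fmorph_div !rmorph_nat ltW // sqrt5_lt.
have vD (x y : algR) : algRval (x + y) = algRval x + algRval y by exact: rmorphD.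
have vB (x y : algR) : algRval (x - y) = algRval x - algRval y by exact: rmorphB.
have vM (x y : algR) : algRval (x * y) = algRval x * algRval y by exact: rmorphM.
have vz (i : int) : algRval i%:~R = i%:~R by exact: rmorph_int.
have v2 (i : nat) (x : algR) : algRval (x / i%:R) = algRval x / i%:R.
  by rewrite fmorph_div rmorph_nat.
have v3 : algRval (3 / 2) = 3 / 2 by rewrite v2 rmorph_nat.
exists m, n; split.
  have := h1 : `|algRval _| <= algRval _.
  by rewrite v3 !(v2, vB, vD, vM, vz) rmorph1.
have := h2 : `|algRval _| <= algRval _.
by rewrite v3 !(v2, vB, vD, vM, vz) rmorph1.
Qed.

Definition shift_conjs (k : nat) (M N : rat) : seq algC :=
  [:: ratr M + ratr N * sqrt5 + beta k; ratr M + ratr N * sqrt5 - beta k;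
      ratr M - ratr N * sqrt5 + beta' k; ratr M - ratr N * sqrt5 - beta' k].

(** Pairing the factors gives (P1 + sqrt5 P2)(P1 - sqrt5 P2) = P1^2 - 5 P2^2, a rational polynomial
    vanishing at the shifted generator. *)
Lemma minCpoly_shift_dvd (k : nat) (M N : rat) :
  minCpoly (ratr M + ratr N * sqrt5 + beta k) %|
    \prod_(x <- shift_conjs k M N) ('X - x%:P).
Proof.
pose P1 : {poly rat} := 'X^2 - (2 * M) *: 'X + (M * M + 5 * (N * N) - 5 * k%:R)%:P.
pose P2 : {poly rat} := - (2 * N) *: 'X + (2 * (M * N) - k%:R)%:P.
pose h := P1 * P1 - 5%:P * (P2 * P2).
have hE : map_poly ratr h = \prod_(x <- shift_conjs k M N) ('X - x%:P).
  have e1 : map_poly ratr P1 = 'X^2 - (2 * (ratr M)%:P) * 'X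
     + ((ratr M)%:P * (ratr M)%:P + 5 * ((ratr N)%:P * (ratr N)%:P) - 5 * k%:R)
     :> {poly algC}.
    rewrite rmorphD rmorphB /= map_polyZ map_polyXn map_polyX map_polyC /=.
    rewrite !(ratr_nat, ratrM, ratrB, ratrD) -mul_polyC.
    by rewrite !(polyCB, polyCD, polyCM) !polyC_natr.
  have e2 : map_poly ratr P2 = - (2 * (ratr N)%:P) * 'X
     + (2 * ((ratr M)%:P * (ratr N)%:P) - k%:R) :> {poly algC}.
    rewrite rmorphD /= map_polyZ map_polyX map_polyC /=.
    rewrite !(ratr_nat, ratrN, ratrM, ratrB, ratrD) -mul_polyC.
    by rewrite polyCN !(polyCB, polyCM) !polyC_natr.
  have s2 : sqrt5%:P ^+ 2 = 5 :> {poly algC} by rewrite -polyC_exp sqr_sqrt5 polyC_natr.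
  have b2 : (beta k)%:P ^+ 2 = k%:R * (5 + sqrt5%:P) :> {poly algC}.
    by rewrite -polyC_exp sqr_beta polyCM polyCD !polyC_natr.
  have b2' : (beta' k)%:P ^+ 2 = k%:R * (5 - sqrt5%:P) :> {poly algC}.
    by rewrite -polyC_exp sqr_beta' polyCM polyCB !polyC_natr.
  have E1 : ('X - (ratr M + ratr N * sqrt5 + beta k)%:P) *
      ('X - (ratr M + ratr N * sqrt5 - beta k)%:P) =
      map_poly ratr P1 + sqrt5%:P * map_poly ratr P2.
    by rewrite e1 e2 polyCB !polyCD !polyCM; ring: s2 b2.
  have E2 : ('X - (ratr M - ratr N * sqrt5 + beta' k)%:P) *
      ('X - (ratr M - ratr N * sqrt5 - beta' k)%:P) =
      map_poly ratr P1 - sqrt5%:P * map_poly ratr P2.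
    by rewrite e1 e2 !polyCD !polyCN !polyCM; ring: s2 b2'.
  rewrite !big_cons big_nil mulr1 mulrA E1 E2 /h rmorphB !rmorphM /= map_polyC /=.
  by rewrite ratr_nat polyC_natr; ring: s2.
have [q [-> _] qP] := minCpolyP (ratr M + ratr N * sqrt5 + beta k).
by rewrite -hE dvdp_map -qP hE root_prod_XsubC mem_head.
Qed.

(** The roots of the minimal polynomial form a subsequence of [l], and the omitted factors are at
    least 1. *)
Lemma alg_mahler_le (a : algC) (l : seq algC) : a \in Aint ->
  minCpoly a %| \prod_(x <- l) ('X - x%:P) ->
  exists2 m, alg_mahler a m & m <= \prod_(x <- l) mahler_factor x.
Proof.
move=> aA /dvdp_prod_XsubC[b].
rewrite eqp_monic ?minCpoly_monic ?monic_prod_XsubC // => /eqP aE.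
exists (\prod_(x <- mask b l) mahler_factor x).
  exists (minCpoly a); split.
    (* For an algebraic integer the monic minimal polynomial is already integral. *)
    exists 1%N; rewrite scale1r; split=> //; split=> //; split=> //.
    by case.
  exists (mask b l); rewrite (monicP (minCpoly_monic a)) scale1r normr1 mul1r.
  by rewrite prod_mahler_factor.
elim: l b {aE} => [|x l IH] [|[] b] /=; rewrite ?big_nil ?prod_mahler_factor_ge1 //.
  by rewrite !big_cons ler_wpM2l ?IH // (le_trans _ (mahler_factor_ge1 x)).
rewrite big_cons (le_trans (IH b)) // ler_peMl ?mahler_factor_ge1 //.
exact: le_trans (prod_mahler_factor_ge1 l).
Qed.

Lemma in_Qgen_sqrt5 (k : nat) : (0 < k)%N -> in_Qgen (beta k) sqrt5.
Proof.
move=> k0; have kC : k%:R != 0 :> algC by rewrite pnatr_eq0 -lt0n.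
have -> : sqrt5 = beta k * beta k * ratr k%:R^-1 + ratr (- 5).
  by rewrite -expr2 sqr_beta fmorphV rmorphN /= !ratr_nat; field.
apply: in_QgenD; last exact: in_Qgen_rat.
by apply: in_QgenM (in_Qgen_rat _ _); apply: in_QgenM; exact: in_Qgen_id.
Qed.

Lemma same_field_shift (k : nat) (M N : rat) : (0 < k)%N -> coprime k 5 ->
  same_field (beta k) (ratr M + ratr N * sqrt5 + beta k).
Proof.
move=> k0 k5; have kC : k%:R != 0 :> algC by rewrite pnatr_eq0 -lt0n.
split.
  apply: in_QgenD (in_Qgen_id _); apply: in_QgenD (in_Qgen_rat _ _) _.
  exact: in_QgenM (in_Qgen_rat _ _) (in_Qgen_sqrt5 k0).
set a := ratr M + _ + _; have s2 := sqr_sqrt5; have b2 := sqr_beta k.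
(* Expanding [(a - M - N sqrt5)^2 = k (5 + sqrt5)] gives [delta sqrt5] as a
   quadratic polynomial in [a]. *)
pose delta := ratr (- (2 * N)) * a + ratr (2 * (M * N) - k%:R).
have delta0 : delta != 0.
  apply/eqP => d0.
  (* Substituting sqrt5 = beta^2 / k - 5 gives p(beta) = -delta. If this vanishes, so does p(-beta);
     the difference 4 N beta forces N = 0, and then delta = -k. *)
  pose p : {poly rat} :=
    (2 * (N * N) / k%:R) *: 'X^2 + (2 * N) *: 'X + (k%:R - 10 * (N * N))%:P.
  have pE r : ev p r = ratr (2 * (N * N) / k%:R) * r ^+ 2 + ratr (2 * N) * r
      + ratr (k%:R - 10 * (N * N)).
    rewrite /p; move: (k%:R - _) => c.
    rewrite 2!rmorphD /= !map_polyZ map_polyXn map_polyX map_polyC /=.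
    by rewrite !hornerD !hornerZ hornerXn hornerX hornerC.
  have pb : ev p (beta k) = 0.
    rewrite pE -[RHS]oppr0 -d0 /delta /a.
    rewrite !(ratr_nat, fmorphV, ratrN, ratrM, ratrB) /= ?ratr_nat.
    by field: s2 b2.
  have pb' : ev p (- beta k) = 0.
    apply: (@root_minCpoly_conj (beta k)) => //.
    by rewrite root_minCpoly_beta // !inE eqxx orbT.
  have N0 : ratr N = 0 :> algC.
    apply: (mulfI (_ : 4 * beta k != 0)).
      by rewrite mulf_neq0 ?pnatr_eq0 // gt_eqF // beta_gt0.
    rewrite mulr0 -(subrr 0) -{1}pb -pb' !pE sqrrN [ratr (2 * N)]ratrM ratr_nat.
    by ring.
  move: d0; rewrite /delta !(ratr_nat, ratrN, ratrM, ratrB) N0 => /eqP.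
  by rewrite !(mulr0, oppr0, mul0r, add0r, sub0r) oppr_eq0 (negPf kC).
have sE : sqrt5 = (ratr (5 * k%:R) - a * a + ratr (2 * M) * a
    - ratr (M * M + 5 * (N * N))) * delta^-1.
  apply: (mulIf delta0); rewrite mulfVK // /delta /a.
  rewrite !(ratr_nat, ratrN, ratrM, ratrB, ratrD).
  by ring: s2 b2.
have aa := in_Qgen_id a.
have sa : in_Qgen a sqrt5.
  rewrite sE; apply: in_QgenM.
    apply: in_QgenD; last by apply: in_QgenN; exact: in_Qgen_rat.
    apply: in_QgenD; last by apply: in_QgenM aa; exact: in_Qgen_rat.
    by apply: in_QgenD (in_Qgen_rat _ _) _; apply: in_QgenN; exact: in_QgenM.
  apply/in_QgenV/in_QgenD/in_Qgen_rat.
  exact: in_QgenM (in_Qgen_rat _ _) aa.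
have -> : beta k = a - (ratr M + ratr N * sqrt5) by rewrite /a addrAC subrr add0r.
apply: in_QgenD aa _; apply: in_QgenN; apply: in_QgenD (in_Qgen_rat _ _) _.
exact: in_QgenM (in_Qgen_rat _ _) sa.
Qed.

(** The left side is 18 k sqrt5 + (27/4)(beta + beta') + 81/16; the bounds beta + beta' <= 5k, sqrt5
    > 2 and k >= 1 suffice. *)
Lemma shift_mahler_bound (k : nat) : (0 < k)%N ->
  (2 * beta k + 3 / 2) * (3 / 2) * ((2 * beta' k + 3 / 2) * (3 / 2))
    <= 40 * k%:R * sqrt5.
Proof.
move=> k0; have k1 : 0 <= k%:R - 1 :> algC by rewrite subr_ge0 ler1n.
have k0' : 0 <= k%:R :> algC by [].
(* (beta + beta')^2 = 10 k + 4 k sqrt5 <= 19 k <= 25 k^2. *)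
have bs : 0 <= 5 * k%:R - (beta k + beta' k).
  have b0 := ltW (beta_gt0 k0); have b0' := ltW (beta'_gt0 k0).
  rewrite subr_ge0 -(ler_pXn2r (n := 2)) ?nnegrE ?addr_ge0 ?mulr_ge0 //.
  rewrite -subr_ge0.
  have -> : (5 * k%:R) ^+ 2 - (beta k + beta' k) ^+ 2 =
      25 * k%:R * (k%:R - 1) + 6 * k%:R + 4 * k%:R * (9 / 4 - sqrt5).
    rewrite sqrrD sqr_beta sqr_beta' beta_mul; by field.
  have s9 : 0 <= 9 / 4 - sqrt5 by rewrite subr_ge0 ltW // sqrt5_lt.
  by apply: addr_ge0; [apply: addr_ge0|]; rewrite !mulr_ge0.
rewrite -subr_ge0.
have -> : 40 * k%:R * sqrt5 -
    (2 * beta k + 3 / 2) * (3 / 2) * ((2 * beta' k + 3 / 2) * (3 / 2)) =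
  22 * k%:R * (sqrt5 - 2) + 27 / 4 * (5 * k%:R - (beta k + beta' k))
    + 83 / 16 * k%:R + 81 / 16 * (k%:R - 1).
  by field: (beta_mul k).
have s2 : 0 <= sqrt5 - 2 by rewrite subr_ge0 ltW // sqrt5_gt2.
by apply: addr_ge0; [apply: addr_ge0; [apply: addr_ge0|]|]; rewrite !mulr_ge0 ?invr_ge0.
Qed.

Lemma exists_small_mahler (k : nat) : (0 < k)%N -> coprime k 5 ->
  exists a m, [/\ in_OK (beta k) a, same_field (beta k) a, alg_mahler a m
                & m <= 40 * k%:R * sqrt5].
Proof.
move=> k0 k5; have [m [n [h1 h2]]] := golden_round_beta k0.
(* Coordinates of m + n phi in the basis 1, sqrt5. *)
pose M : rat := m%:~R + n%:~R / 2; pose N : rat := n%:~R / 2.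
have ME : ratr M = m%:~R + n%:~R / 2 :> algC.
  by rewrite rmorphD /= fmorph_div /= !ratr_int ratr_nat.
have NE : ratr N = n%:~R / 2 :> algC by rewrite fmorph_div /= ratr_int ratr_nat.
pose a := ratr M + ratr N * sqrt5 + beta k.
have aE : a = m%:~R + n%:~R * phi + beta k by rewrite /a ME NE /phi; field.
have aA : a \in Aint.
  rewrite aE; apply: rpredD (Aint_beta k); apply: rpredD (Aint_int m) _.
  exact: rpredM (Aint_int n) Aint_phi.
have sf := same_field_shift M N k0 k5.
have [m' am' m'le] := alg_mahler_le aA (minCpoly_shift_dvd k M N).
exists a, m'; split => //; first by split => //; case: sf.
apply: le_trans m'le (le_trans _ (shift_mahler_bound k0)).
have b0 := ltW (beta_gt0 k0); have b0' := ltW (beta'_gt0 k0).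
have h32 : 1 <= 3 / 2 :> algC by rewrite ler_pdivlMr // mul1r ler_nat.
have h0 : 0 <= 3 / 2 :> algC by rewrite divr_ge0.
have g0 r : 0 <= mahler_factor r by exact: le_trans (mahler_factor_ge1 r).
have bound (x b : algC) : 0 <= b -> `|x - b| <= 3 / 2 ->
    mahler_factor (x + b) * mahler_factor (x - b) <= (2 * b + 3 / 2) * (3 / 2).
  move=> bp xb; rewrite ler_pM //; last exact: mahler_factor_le.
  apply: mahler_factor_le; first by rewrite (le_trans h32) // lerDr mulr_ge0.
  have -> : x + b = 2 * b + (x - b) by ring.
  by rewrite (le_trans (ler_normD _ _)) // lerD // ger0_norm // mulr_ge0.
rewrite !big_cons big_nil mulr1 mulrA.
rewrite ler_pM ?mulr_ge0 //; apply: bound => //.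
  rewrite (le_trans _ h1) // le_eqVlt; apply/orP; left; apply/eqP; congr `|_ - _|.
  by rewrite ME NE /phi; field.
rewrite (le_trans _ h2) // le_eqVlt; apply/orP; left; apply/eqP; congr `|_ - _|.
by rewrite ME NE /phi'; field.
Qed.

(** * Both bounds in terms of the discriminant *)

Theorem theorem5p3 (k : nat) :
  (1 <= k)%N -> odd k -> squarefree k -> coprime k 5 ->
  forall D m : algC,
    abs_disc (sqrtC (k%:R * (5 + sqrtC 5))) D ->
    is_mahler_OK (sqrtC (k%:R * (5 + sqrtC 5))) m ->
    (1 / 1920%:R) * sqrtC D <= m /\ m <= sqrtC D.
Proof.
move=> k0 ko sqf k5 D m discD [[a [aO [aK am]]] mmin].
rewrite (sqrt_abs_disc k0 ko k5 sqf discD); split.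
  (* The bound 2 k sqrt5 equals sqrt(D) / 20. *)
  apply: le_trans (alg_mahler_ge k0 ko k5 sqf aO aK am).
  rewrite -!mulrA !mulrA ler_wpM2r ?sqrt5_ge0 // ler_wpM2r // mul1r.
  by rewrite mulrC ler_pdivrMr ?ltr0n // -natrM ler_nat.
have [b [mb [bO bK bm]]] := exists_small_mahler k0 k5.
exact: le_trans (mmin _ _ bO bK bm).
Qed.
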